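(* Let $\alpha\in(0,1]$ and let $f_S(R)\in[0,1]$, for $S\subseteq\mathcal I$ and finite $R\subseteq\mathcal I$, be a bounded loss satisfying $$S\subseteq T\ \Longrightarrow\ f_S(R)\le f_T(R),\qquad f_S(R)=f_{S\cap R}(R).$$ Then the following hold. (1) (Stopped loss.) If $\mathbf E$ is a future-extension coherent dynamic intersection $e$-process collection, then for every $P\in\mathcal M$ and every $(\mathcal F_t)$-stopping time $\tau$ with $P(\tau<\infty)=1$, $\mathbb E_P[\max_{R\in\mathfrak R^f_{\alpha,\tau}(\mathbf E)}f_{\mathcal N(P)}(R)]\le\alpha$. (2) (Persistent supremum loss.) If $\mathbf E$ is moreover time-monotone, then $\mathbb E_P[\sup_{t\ge0}\max_{R\in\mathfrak R^f_{\alpha,t}(\mathbf E)}f_{\mathcal N(P)}(R)]\le\alpha$ for every $P\in\mathcal M$, and, pointwise on $\Omega$, $\mathfrak R^f_{\alpha,t}(\mathbf E)\subseteq\mathfrak R^f_{\alpha,u}(\mathbf E)$ for $t\le u$. (3) (Canonical converse, stopped.) If a candidate-family process $\mathcal C$ satisfies $\mathbb E_P[L_\tau^{\mathcal N(P)}(\mathcal C)]\le\alpha$ for all $P\in\mathcal M$ and all $(\mathcal F_t)$-stopping times $\tau$ with $P(\tau<\infty)=1$, then $E^{S,\mathrm{can}}_t:=\alpha^{-1}L_t^S(\mathcal C)$ ($S$ finite nonempty) is a future-extension coherent dynamic intersection $e$-process collection and $\mathcal C_t\subseteq\mathfrak R^f_{\alpha,t}(\mathbf E^{\mathrm{can}})$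 for every $t$. (4) (Canonical converse, supremum.) If $\mathcal C$ satisfies $\mathbb E_P[\sup_{t\ge0}L_t^{\mathcal N(P)}(\mathcal C)]\le\alpha$ for all $P\in\mathcal M$, then $\overline E^{S,\mathrm{can}}_t:=\alpha^{-1}\overline L_t^S(\mathcal C)$ ($S$ finite nonempty) is a future-extension coherent, time-monotone dynamic intersection $e$-process collection and $\mathcal C_t\subseteq\mathfrak R^f_{\alpha,t}(\overline{\mathbf E}^{\mathrm{can}})$ for every $t$. (5) (Minimality.) Let $\mathcal C$ be any candidate-family process and let $\mathbf E$ be a future-extension coherent dynamic intersection $e$-process collection with $\mathcal C_t\subseteq\mathfrak R^f_{\alpha,t}(\mathbf E)$ for every $t$. Then $\alpha^{-1}L_t^S(\mathcal C)\le E^S_t$ for every finite nonempty $S$ and every $t$; if $\mathbf E$ is also time-monotone, then $\alpha^{-1}\overline L_t^S(\mathcal C)\le E^S_t$ for every finite nonempty $S$ and every $t$. (6) (Hulls.) The current and running hull maps $\mathcal C\mapsto(\mathsf H_t(\mathcal C))_{t\ge0}$ and $\mathcal C\mapsto(\overline{\mathsf H}_t(\mathcal C))_{t\ge0}$ are closure operators on candidate-family processes ordered by pointwise inclusion, i.e. they are extensive, monotone and idempotent.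
   Context: Let $(\Omega,\mathcal F,(\mathcal F_t)_{t\in\mathbb N_0})$ be a discrete-time filtered measurable space, $\mathcal M$ a family of probability measures on $(\Omega,\mathcal F)$, $\mathcal I\subseteq\mathbb N$ an index set (finite or infinite), and $H_i\subseteq\mathcal M$, $i\in\mathcal I$, null hypotheses. Put $\mathcal N(P)=\{i\in\mathcal I:P\in H_i\}$ and, for finite $S\subseteq\mathcal I$, $H_S=\bigcap_{i\in S}H_i$ (with $H_\varnothing=\mathcal M$). The active sets $I_t\subseteq\mathcal I$ are deterministic and finite with $I_0\subseteq I_1\subseteq\cdots$ and $\bigcup_t I_t=\mathcal I$. A candidate-family process $\mathcal C=(\mathcal C_t)_{t\ge0}$ consists of nonempty random families $\mathcal C_t\subseteq 2^{I_t}$ with $\{R\in\mathcal C_t\}\in\mathcal F_t$ for every deterministic $R\subseteq I_t$. A nonnegative $(\mathcal F_t)$-adapted process $E=(E_t)_{t\ge0}$ is an $e$-process for $H\subseteq\mathcal M$ if $\mathbb E_P[E_\tau]\le1$ for every $P\in H$ and every $(\mathcal F_t)$-stopping time $\tau$ with $P(\tau<\infty)=1$. A dynamic intersection $e$-process collection is a family $\mathbf E=(E^S_t)_{t\ge0,\ S\subseteq\mathcal I,\ 0<|S|<\infty}$ such that $E^S$ is an $e$-process for $H_S$ for each nonempty finite $S$. It is future-extension coherent if, pointwise on $\Omega$, $E_t^{S\cap I_t}\le E_t^S$ for every $t$ and every finite $S$ with $S\cap I_t\ne\varnothing$. It is time-monotone if, pointwise on $\Omega$, $E^S_t\le E^S_u$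 for all $t\le u$ and every finite nonempty $S$. For the loss $f$ define, for $S\subseteq\mathcal I$, $L_t^S(\mathcal C)=\max_{R\in\mathcal C_t}f_{S\cap I_t}(R)$ (current loss profile), $\overline L_t^S(\mathcal C)=\max_{0\le u\le t}L_u^S(\mathcal C)$ (running loss profile), $\mathfrak R^f_{\alpha,t}(\mathbf E)=\{R\subseteq I_t:\ f_S(R)\le\alpha E_t^S\text{ for every nonempty }S\subseteq I_t\}$ (closure family), $\mathsf H_t(\mathcal C)=\{R\subseteq I_t:\ f_S(R)\le L_t^S(\mathcal C)\text{ for every }S\subseteq I_t\}$ (current hull), $\overline{\mathsf H}_t(\mathcal C)=\{R\subseteq I_t:\ f_S(R)\le\overline L_t^S(\mathcal C)\text{ for every }S\subseteq I_t\}$ (running hull).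
   Formalization: Parts (1), (2) and (5) additionally assume f_∅(R)=0 for every finite R (no true null, no loss); without it they fail, e.g. for f≡1, α=1/2, all H_i empty and E≡2. *)

(* Defs.v *)
From mathcomp Require Export all_boot all_order all_algebra.
From mathcomp Require Export finmap.
From mathcomp Require Export all_classical all_reals all_analysis.
From mathcomp Require Export measurable_realfun.

Set Implicit Arguments.
Unset Strict Implicit.
Unset Printing Implicit Defensive.

Import Order.TTheory GRing.Theory Num.Theory.
Import numFieldNormedType.Exports.

Local Open Scope classical_set_scope.
Local Open Scope ring_scope.

Definition filtration d (Omega : measurableType d)
    (F : nat -> set (set Omega)) : Prop :=
  [/\ forall t, sigma_algebra setT (F t),
      forall t, F t `<=` measurable
    & forall s t, (s <= t)%N -> F s `<=` F t].

Definition adapted d (Omega : measurableType d) (R : realType)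
    (F : nat -> set (set Omega)) (X : nat -> Omega -> \bar R) : Prop :=
  forall t (B : set (\bar R)), measurable B -> F t (X t @^-1` B).

(* [None] is the value infinity. *)
Definition stopping_time d (Omega : measurableType d)
    (F : nat -> set (set Omega)) (tau : Omega -> option nat) : Prop :=
  forall t, F t [set w | exists2 n, tau w = Some n & (n <= t)%N].

Definition as_finite d (Omega : measurableType d) (R : realType)
    (P : probability Omega R) (tau : Omega -> option nat) : Prop :=
  P [set w | tau w <> None] = 1%E.

(* The value 0 on {tau = oo} is a convention: it is only ever used when this
   event is null. *)
Definition stopped (Omega : Type) (R : realType)
    (X : nat -> Omega -> \bar R) (tau : Omega -> option nat) (w : Omega) :
    \bar R :=
  if tau w is Some n then X n w else 0%E.

(* Null hypotheses are indexed by [Idx : set nat]; [H i] is only meaningful for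
   [i] in [Idx]. *)
Definition true_nulls d (Omega : measurableType d) (R : realType)
    (Idx : set nat) (H : nat -> set (probability Omega R))
    (P : probability Omega R) : set nat :=
  [set i | Idx i /\ H i P].

Definition intersection_null d (Omega : measurableType d) (R : realType)
    (M : set (probability Omega R)) (H : nat -> set (probability Omega R))
    (S : {fset nat}) : set (probability Omega R) :=
  [set P | M P /\ forall i, i \in S -> H i P].

Definition active_sets (Idx : set nat) (act : nat -> {fset nat}) : Prop :=
  (forall s t, (s <= t)%N -> (act s `<=` act t)%fset) /\
  \bigcup_t [set` act t] = Idx.

Definition candidate_process d (Omega : measurableType d)
    (F : nat -> set (set Omega)) (act : nat -> {fset nat})
    (C : nat -> Omega -> {fset {fset nat}}) : Prop :=
  [/\ forall t w, C t w != fset0,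
      forall t w Q, Q \in C t w -> (Q `<=` act t)%fset
    & forall t Q, (Q `<=` act t)%fset -> F t [set w | Q \in C t w]].

(* Values in [0, +oo]; real-valued processes are a special case. *)
Definition e_process d (Omega : measurableType d) (R : realType)
    (F : nat -> set (set Omega)) (H : set (probability Omega R))
    (E : nat -> Omega -> \bar R) : Prop :=
  [/\ forall t w, (0 <= E t w)%E,
      adapted F E
    & forall P, H P -> forall tau, stopping_time F tau -> as_finite P tau ->
        (\int[P]_w stopped E tau w <= 1)%E].

(* Only the components [E S] with [S] nonempty and included in [Idx] are
   constrained; similarly below. *)
Definition e_collection d (Omega : measurableType d) (R : realType)
    (F : nat -> set (set Omega)) (M : set (probability Omega R))
    (Idx : set nat) (H : nat -> set (probability Omega R))
    (E : {fset nat} -> nat -> Omega -> \bar R) : Prop :=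
  forall S, S != fset0 -> [set` S] `<=` Idx ->
    e_process F (intersection_null M H S) (E S).

Definition extension_coherent (Omega : Type) (R : realType)
    (Idx : set nat) (act : nat -> {fset nat})
    (E : {fset nat} -> nat -> Omega -> \bar R) : Prop :=
  forall t S, [set` S] `<=` Idx -> (S `&` act t)%fset != fset0 ->
    forall w, (E (S `&` act t)%fset t w <= E S t w)%E.

Definition time_monotone (Omega : Type) (R : realType) (Idx : set nat)
    (E : {fset nat} -> nat -> Omega -> \bar R) : Prop :=
  forall S, S != fset0 -> [set` S] `<=` Idx ->
    forall t u, (t <= u)%N -> forall w, (E S t w <= E S u w)%E.

(* [f S Q] is the loss of the rejection set [Q] when [S] is the set of true
   nulls. *)
Definition bounded_loss (R : realType) (Idx : set nat)
    (f : set nat -> {fset nat} -> R) : Prop :=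
  [/\ forall S Q, S `<=` Idx -> [set` Q] `<=` Idx -> 0 <= f S Q <= 1,
      forall S T Q, T `<=` Idx -> [set` Q] `<=` Idx ->
        S `<=` T -> f S Q <= f T Q
    & forall S Q, S `<=` Idx -> [set` Q] `<=` Idx ->
        f S Q = f (S `&` [set` Q]) Q].

(* No loss is incurred when there is no true null.  This does not follow from
   [bounded_loss] (take [f] constant equal to 1). *)
Definition null_loss (R : realType) (Idx : set nat)
    (f : set nat -> {fset nat} -> R) : Prop :=
  forall Q, [set` Q] `<=` Idx -> f set0 Q = 0.

(* Losses are nonnegative, so that the base value 0 does not affect the maximum
   over a nonempty family. *)
Definition max_loss (R : realType) (f : set nat -> {fset nat} -> R)
    (S : set nat) (A : {fset {fset nat}}) : R :=
  \big[Num.max/0]_(Q <- A) f S Q.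

Definition loss_profile (Omega : Type) (R : realType)
    (act : nat -> {fset nat}) (f : set nat -> {fset nat} -> R)
    (C : nat -> Omega -> {fset {fset nat}}) (S : set nat) (t : nat)
    (w : Omega) : R :=
  max_loss f (S `&` [set` act t]) (C t w).

Definition running_loss_profile (Omega : Type) (R : realType)
    (act : nat -> {fset nat}) (f : set nat -> {fset nat} -> R)
    (C : nat -> Omega -> {fset {fset nat}}) (S : set nat) (t : nat)
    (w : Omega) : R :=
  \big[Num.max/0]_(u < t.+1) loss_profile act f C S u w.

Definition closure_family (Omega : Type) (R : realType)
    (act : nat -> {fset nat}) (f : set nat -> {fset nat} -> R) (alpha : R)
    (E : {fset nat} -> nat -> Omega -> \bar R) (t : nat) (w : Omega) :
    {fset {fset nat}} :=
  [fset Q in fpowerset (act t) |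
    `[< forall S : {fset nat}, S != fset0 -> (S `<=` act t)%fset ->
          ((f [set` S] Q)%:E <= alpha%:E * E S t w)%E >]]%fset.

Definition current_hull (Omega : Type) (R : realType)
    (act : nat -> {fset nat}) (f : set nat -> {fset nat} -> R)
    (C : nat -> Omega -> {fset {fset nat}}) (t : nat) (w : Omega) :
    {fset {fset nat}} :=
  [fset Q in fpowerset (act t) |
    `[< forall S : {fset nat}, (S `<=` act t)%fset ->
          f [set` S] Q <= loss_profile act f C [set` S] t w >]]%fset.

Definition running_hull (Omega : Type) (R : realType)
    (act : nat -> {fset nat}) (f : set nat -> {fset nat} -> R)
    (C : nat -> Omega -> {fset {fset nat}}) (t : nat) (w : Omega) :
    {fset {fset nat}} :=
  [fset Q in fpowerset (act t) |
    `[< forall S : {fset nat}, (S `<=` act t)%fset ->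
          f [set` S] Q <= running_loss_profile act f C [set` S] t w >]]%fset.

Definition process_le (Omega : Type)
    (C D : nat -> Omega -> {fset {fset nat}}) : Prop :=
  forall t w, (C t w `<=` D t w)%fset.

Definition closure_operator (T : Type) (D : set T) (le : T -> T -> Prop)
    (h : T -> T) : Prop :=
  [/\ forall x, D x -> D (h x),
      forall x, D x -> le x (h x),
      forall x y, D x -> D y -> le x y -> le (h x) (h y)
    & forall x, D x -> h (h x) = h x].

(* Main.v *)
Require Import Defs.
From mathcomp Require Import all_boot all_order all_algebra finmap.
From mathcomp Require Import all_classical all_reals all_analysis.
From mathcomp Require Import measurable_realfun.

Import Order.TTheory GRing.Theory Num.Theory.
Local Open Scope classical_set_scope.
Local Open Scope ring_scope.

(** Why the theorem holds.  Fix [P] with null set [N], and let [Q] be a member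
    of the closure family at time [t].  Since [Q] lies in [act t] and the loss
    depends on [N] only through [N `&` Q], the loss of [Q] under [N] equals its
    loss under the finite set [N `&` act t], and the closure condition at that
    set bounds it by [alpha] times one e-process.  The difficulty is that this
    e-process changes with [t].  Up to a fixed horizon [n] it does not have to:
    coherence lets the single e-process of [N `&` act n] dominate all of them
    ([closure_loss_le_horizon]).  Hence the loss stopped at [tau] and set to
    zero on the event [n < tau] has expectation at most [alpha], by the
    e-process property at [minn n tau], and monotone convergence in [n] removes
    the horizon ([stopped_loss_le]).  If the collection is time monotone, the
    closure families increase, so the supremum over time is an increasing limit
    of the losses at deterministic times ([supremum_loss_le]).

    The converses use that the loss profile is monotone in its set: when [P] is
    in the intersection null of [S], the profile of [S] is dominated by that of
    [N], so the assumed bound makes the normalized profile an e-process.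
    Minimality is the closure bound maximized over the candidates
    ([loss_profile_le_coherent]).  Finally, passing to a hull does not change
    the profile that defines it ([current_hull_profile],
    [running_hull_profile]), which gives idempotence.

    Measurability rests on one remark.  A candidate family takes values in the
    countable type of finite families, so every function of it, or of its
    finite history, is measurable as soon as the membership events are
    ([observable_fset], [observable_map]). *)

Set Implicit Arguments.
Unset Strict Implicit.
Unset Printing Implicit Defensive.

(** * Countable operations in a sigma-algebra *)

Section SigmaAlgebra.
Context {T : Type} {G : set (set T)}.
Hypothesis sG : sigma_algebra [set: T] G.

Lemma sigma_algebra_setC (A : set T) : G A -> G (~` A).
Proof. by case: sG => _ GC _ /GC; rewrite setTD. Qed.

Lemma sigma_algebra_cst (p : Prop) : G [set _ : T | p].
Proof.
case: (pselect p) => [pT|pF].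
  rewrite (_ : mkset _ = ~` set0).
    by apply: sigma_algebra_setC; case: sG.
  by rewrite setC0; apply/seteqP; split.
by rewrite (_ : mkset _ = set0); [case: sG | apply/seteqP; split].
Qed.

Lemma sigma_algebra_bigcup_countType (I : countType) (A : I -> set T) :
  (forall i, G (A i)) -> G (\bigcup_i A i).
Proof.
move=> GA; case: sG => G0 _ GU.
rewrite (_ : \bigcup_i A i =
  \bigcup_n (if choice.unpickle n is Some i then A i else set0)).
  by apply: GU => n; case: (choice.unpickle n).
apply/seteqP; split => w [i _ Aw].
  by exists (choice.pickle i) => //; rewrite choice.pickleK.
by case: (choice.unpickle i) Aw => // j Ajw; exists j.
Qed.

Lemma sigma_algebra_bigcap_countType (I : countType) (A : I -> set T) :
  (forall i, G (A i)) -> G (\bigcap_i A i).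
Proof.
move=> GA; rewrite -[X in G X]setCK setC_bigcap; apply: sigma_algebra_setC.
by apply: sigma_algebra_bigcup_countType => i; apply: sigma_algebra_setC.
Qed.

Lemma sigma_algebra_setI2 (A B : set T) : G A -> G B -> G (A `&` B).
Proof.
move=> GA GB; rewrite (_ : A `&` B = \bigcap_b (if b then A else B)).
  by apply: sigma_algebra_bigcap_countType => -[].
apply/seteqP; split => [w [Aw Bw] []//|w ABw].
by split; [apply: (ABw true) | apply: (ABw false)].
Qed.

End SigmaAlgebra.

(** * Maps all of whose preimages are events *)

(** Measurability with respect to the discrete sigma-algebra on the target.  It
    is preserved by composition with arbitrary functions, such as the maximum
    of a loss over a family. *)
Definition observable {T U : Type} (G : set (set T)) (X : T -> U) : Prop :=
  forall B : set U, G (X @^-1` B).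

Section Observable.
Context {T : Type} {G : set (set T)}.
Hypothesis sG : sigma_algebra [set: T] G.

Lemma observable_comp (U V : Type) (X : T -> U) (g : U -> V) :
  observable G X -> observable G (fun w => g (X w)).
Proof. by move=> oX B; exact: oX (g @^-1` B). Qed.

Lemma observable_countType (U : countType) (X : T -> U) :
  (forall u, G (X @^-1` [set u])) -> observable G X.
Proof.
move=> GX B.
rewrite (_ : X @^-1` B = \bigcup_u (X @^-1` [set u] `&` [set _ | B u])).
  apply: sigma_algebra_bigcup_countType => // u.
  by apply: sigma_algebra_setI2 => //; exact: sigma_algebra_cst.
by apply/seteqP; split => [w BXw|w [u _ [<-]]//]; exists (X w).
Qed.

(** The event that [X] equals a given finite set is a countable intersection
    of membership events and of their complements. *)
Lemma observable_fset (U : countType) (X : T -> {fset U}) :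
  (forall u, G [set w | u \in X w]) -> observable G X.
Proof.
move=> GX; apply: observable_countType => A.
rewrite (_ : X @^-1` _ = \bigcap_u
  (if u \in A then [set w | u \in X w] else ~` [set w | u \in X w])).
  apply: sigma_algebra_bigcap_countType => // u; case: ifP => _ //.
  exact: sigma_algebra_setC.
apply/seteqP; split => [w <- u _|w XAw]; first by case: ifPn => // /negP.
apply/fsetP => u; have := XAw u I; case: ifPn => _ /=; first by move=> ->.
by move/negP/negbTE.
Qed.

Lemma observable_map (I : eqType) (U : countType) (X : I -> T -> U) s :
  (forall i, i \in s -> observable G (X i)) ->
  observable G (fun w => [seq X i w | i <- s]).
Proof.
elim: s => [|i s IHs] oX.
  by move=> B; exact: (sigma_algebra_cst sG (B [::])).
apply: observable_countType => -[|u v].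
  rewrite (_ : _ @^-1` _ = [set _ | False]); first exact: sigma_algebra_cst.
  by apply/seteqP; split.
rewrite (_ : _ @^-1` _ = X i @^-1` [set u] `&`
    (fun w => [seq X j w | j <- s]) @^-1` [set v]).
  apply: sigma_algebra_setI2 => //; first by apply: oX; rewrite mem_head.
  by apply: IHs => j js; apply: oX; rewrite in_cons js orbT.
by apply/seteqP; split => w /= [<- <-]; split.
Qed.

End Observable.

(** * Stopping times and stopped processes *)

Section Stopping.
Context {d : measure_display} {Omega : measurableType d} {R : realType}.
Context {F : nat -> set (set Omega)}.
Hypothesis HF : filtration F.

Lemma observable_adapted (L : nat -> Omega -> R) :
  (forall t, observable (F t) (L t)) -> adapted F (fun t w => (L t w)%:E).
Proof. by move=> oL t B _; exact: (oL t (EFin @^-1` B)). Qed.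

Lemma adapted_measurable (X : nat -> Omega -> \bar R) t :
  adapted F X -> measurable_fun setT (X t).
Proof.
by case: HF => _ Fm _ aX _ B mB; rewrite setTI; apply: (Fm t); exact: aX.
Qed.

Lemma observable_measurable (L : nat -> Omega -> R) t :
  (forall u, observable (F u) (L u)) ->
  measurable_fun setT (fun w => (L t w)%:E).
Proof. by move=> oL; exact: adapted_measurable (observable_adapted oL). Qed.

Lemma stopping_time_cst t : stopping_time F (fun=> Some t).
Proof. by case: HF => sF _ _ u; exact: sigma_algebra_cst. Qed.

(** The stopping time [minn n tau], which is finite even where [tau] is not. *)
Definition capped (n : nat) (tau : Omega -> option nat) (w : Omega) :
    option nat :=
  Some (if tau w is Some k then minn k n else n).

Lemma stopping_time_capped n tau :
  stopping_time F tau -> stopping_time F (capped n tau).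
Proof.
move=> st t; have [sF _ _] := HF.
have [nt|tn] := leqP n t.
  (* Past the cap the stopping decision is deterministic. *)
  rewrite (_ : mkset _ = [set _ | True]); first exact: sigma_algebra_cst.
  apply/seteqP; split => // w _ /=; eexists; first by [].
  by case: (tau w) => // k; rewrite geq_min nt orbT.
rewrite (_ : mkset _ = [set w | exists2 k, tau w = Some k & (k <= t)%N]).
  exact: st.
apply/seteqP; split => w /=; rewrite /capped.
  move=> [k [<-]]; case: (tau w) => [j|]; last by rewrite leqNgt tn.
  by rewrite geq_min [(n <= t)%N]leqNgt tn orbF; exists j.
by move=> [k -> kt]; eexists; [by []|rewrite geq_min kt].
Qed.

Lemma as_finite_total (P : probability Omega R) (tau : Omega -> option nat) :
  (forall w, tau w <> None) -> as_finite P tau.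
Proof.
move=> tauN; rewrite /as_finite (_ : mkset _ = setT) ?probability_setT//.
by apply/seteqP; split => // w _; exact: tauN.
Qed.

Lemma stopping_time_measurable tau k :
  stopping_time F tau -> measurable [set w | tau w = Some k].
Proof.
move=> st; have [_ Fm _] := HF.
rewrite (_ : mkset _ = [set w | exists2 n, tau w = Some n & (n <= k)%N] `\`
   [set w | exists2 n, tau w = Some n & (n < k)%N]).
  apply: measurableD; first exact/Fm/st.
  case: k => [|k]; last exact/Fm/st.
  by rewrite (_ : mkset _ = set0)//; apply/seteqP; split => // w [].
apply/seteqP; split => w /=.
  by move=> tk; split; [exists k | rewrite tk => -[_ [<-]]; rewrite ltnn].
move=> [[n tn nk] tlt]; rewrite tn; congr Some; apply/eqP.
by rewrite eqn_leq nk leqNgt; apply/negP => ltnk; apply: tlt; exists n.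
Qed.

Lemma measurable_stopped (X : nat -> Omega -> \bar R) tau :
  (forall t, measurable_fun setT (X t)) -> stopping_time F tau ->
  measurable_fun setT (stopped X tau).
Proof.
move=> mX st _ B mB; rewrite setTI.
have mtau k : measurable [set w | tau w = Some k].
  exact: stopping_time_measurable.
rewrite (_ : _ @^-1` B =
  \bigcup_k ([set w | tau w = Some k] `&` (X k @^-1` B)) `|`
  (~` (\bigcup_k [set w | tau w = Some k]) `&` [set _ | B 0%E])).
  apply: measurableU.
    apply: bigcupT_measurable => k; apply: measurableI => //.
    by rewrite -[X in measurable X]setTI; exact: mX.
  apply: measurableI.
    by apply: measurableC; exact: bigcupT_measurable.
  case: (pselect (B 0%E)) => b.
    by rewrite (_ : mkset _ = setT)//; apply/seteqP; split.
  by rewrite (_ : mkset _ = set0)//; apply/seteqP; split.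
apply/seteqP; split => w /=; rewrite /stopped.
  case E: (tau w) => [k|] Bw; first by left; exists k.
  by right; split => // -[k _ /=]; rewrite E.
move=> [[k _ [/= -> //]]|[ntau B0]].
by case E: (tau w) => [k|//]; case: ntau; exists k.
Qed.

Lemma measurable_ereal_sup_range (g : nat -> Omega -> \bar R) :
  (forall n, measurable_fun setT (g n)) ->
  measurable_fun setT (fun w => ereal_sup (range (g^~ w))).
Proof.
move=> mg; have := measurable_fun_esups mg 0%N; congr measurable_fun.
apply/funext => w; congr ereal_sup.
by apply/seteqP; split => _ [n _ <-]; exists n.
Qed.

(** Monotone convergence, phrased with a supremum instead of a limit. *)
Lemma integral_ereal_sup_le (P : {measure set Omega -> \bar R})
    (g : nat -> Omega -> \bar R) (a : \bar R) :
  (forall n, measurable_fun setT (g n)) ->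
  (forall n w, (0 <= g n w)%E) ->
  (forall w, {homo g^~ w : n m / (n <= m)%N >-> (n <= m)%E}) ->
  (forall n, (\int[P]_w g n w <= a)%E) ->
  (\int[P]_w ereal_sup (range (g^~ w)) <= a)%E.
Proof.
move=> mg g0 ndg ga.
under eq_integral => w _.
  by rewrite -(cvg_lim _ (ereal_nondecreasing_cvgn (ndg w)))//; over.
rewrite monotone_convergence//.
apply: lime_le; last exact: nearW.
apply: ereal_nondecreasing_is_cvgn => n m nm.
by apply: ge0_le_integral => // w _; exact: ndg.
Qed.

(** Horizon truncation: a stopped nonnegative process is the increasing
    supremum of its restrictions to the events that [tau] is at most [n]. *)
Lemma stopped_ereal_sup (X : nat -> Omega -> \bar R) tau w :
  (forall t, (0 <= X t w)%E) ->
  stopped X tau w = ereal_sup (range (fun n =>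
    stopped (fun k w' => if (k <= n)%N then X k w' else 0%E) tau w)).
Proof.
move=> X0; rewrite /stopped; case: (tau w) => [k|]; apply/eqP; rewrite eq_le.
  apply/andP; split; first by apply: ereal_sup_ubound; exists k; rewrite ?leqnn.
  by apply: ge_ereal_sup => _ [n _ <-]; case: ifP.
apply/andP; split; first by apply: ereal_sup_ubound; exists 0%N.
by apply: ge_ereal_sup => _ [n _ <-].
Qed.

End Stopping.

(** * Losses and loss profiles *)

(** What the pathwise arguments ask of a candidate process.  Closure families,
    which may be empty, also have this property. *)
Definition within_active (Omega : Type) (act : nat -> {fset nat})
    (C : nat -> Omega -> {fset {fset nat}}) : Prop :=
  forall t w Q, Q \in C t w -> (Q `<=` act t)%fset.

Section Losses.
Context {R : realType} {Idx : set nat} {act : nat -> {fset nat}}.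
Context {f : set nat -> {fset nat} -> R}.
Hypothesis Hact : active_sets Idx act.
Hypothesis Hf : bounded_loss Idx f.

Lemma active_subset_index t : [set` act t] `<=` Idx.
Proof. by case: Hact => _ <- i ai; exists t. Qed.

Lemma subset_active_index t (Q : {fset nat}) :
  (Q `<=` act t)%fset -> [set` Q] `<=` Idx.
Proof. by move=> /fsubsetP Qt i /= /Qt; exact: active_subset_index. Qed.

Lemma active_mono s t : (s <= t)%N -> [set` act s] `<=` [set` act t].
Proof. by case: Hact => + _ st => /(_ _ _ st)/fsubsetP. Qed.

(** Both sides equal the loss of [Q] under [S `&` Q].  This is what reduces an
    infinite set of true nulls to a finite one. *)
Lemma loss_active S t (Q : {fset nat}) : S `<=` Idx -> (Q `<=` act t)%fset ->
  f S Q = f (S `&` [set` act t]) Q.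
Proof.
move=> SI Qt; have QI := subset_active_index Qt; case: Hf => _ _ fI.
rewrite fI// [RHS]fI//; last by move=> i [/SI].
by rewrite -setIA [[set` act t] `&` _]setIidr// => i /=; exact: (fsubsetP Qt).
Qed.

Lemma max_loss_ge0 S A : 0 <= max_loss f S A.
Proof. exact: bigmax_ge_id. Qed.

Lemma max_loss_ge S (A : {fset {fset nat}}) Q :
  Q \in A -> f S Q <= max_loss f S A.
Proof. by move=> QA; exact: le_bigmax_seq. Qed.

Lemma max_loss_le S (A : {fset {fset nat}}) (c : R) :
  0 <= c -> (forall Q, Q \in A -> f S Q <= c) -> max_loss f S A <= c.
Proof. by move=> c0 fc; rewrite /max_loss big_seq; exact: bigmax_le. Qed.

Section Profiles.
Context {Omega : Type}.
Implicit Types C D : nat -> Omega -> {fset {fset nat}}.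

Lemma max_loss_profile C S t w : within_active act C -> S `<=` Idx ->
  max_loss f S (C t w) = loss_profile act f C S t w.
Proof. by move=> Ct SI; apply: eq_big_seq => Q /Ct; exact: loss_active. Qed.

(** A profile at time [t] sees its set only through [act t], so replacing the
    set by its part in a later active set changes nothing. *)
Lemma loss_profile_setI C S t u w : (t <= u)%N ->
  loss_profile act f C (S `&` [set` act u]) t w = loss_profile act f C S t w.
Proof.
move=> tu; rewrite /loss_profile -setIA [[set` act u] `&` _]setIidr//.
exact: active_mono.
Qed.

Lemma loss_profile_mono C D S T t w : within_active act C ->
  T `<=` Idx -> S `<=` T -> (C t w `<=` D t w)%fset ->
  loss_profile act f C S t w <= loss_profile act f D T t w.
Proof.
move=> Ct TI ST /fsubsetP CD; apply: max_loss_le; first exact: max_loss_ge0.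
move=> Q QC; apply: le_trans (max_loss_ge _ (CD _ QC)).
case: Hf => _ fle _; apply: fle; last exact: setSI.
- by move=> i [/TI].
- exact: subset_active_index (Ct _ _ _ QC).
Qed.

Lemma running_loss_profile_ge0 C S t w :
  0 <= running_loss_profile act f C S t w.
Proof. exact: bigmax_ge_id. Qed.

Lemma running_loss_profile_ge C S u t w : (u <= t)%N ->
  loss_profile act f C S u w <= running_loss_profile act f C S t w.
Proof.
move=> ut; exact: (le_bigmax 0 (fun i : 'I_t.+1 => loss_profile act f C S i w)
  (Ordinal (ut : (u < t.+1)%N))).
Qed.

Lemma running_loss_profile_le C S t w (c : R) : 0 <= c ->
  (forall u, (u <= t)%N -> loss_profile act f C S u w <= c) ->
  running_loss_profile act f C S t w <= c.
Proof.
by move=> c0 Lc; apply: bigmax_le => // i _; apply: Lc; rewrite -ltnS.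
Qed.

Lemma running_loss_profile_mono C D S T t u w : within_active act C ->
  T `<=` Idx -> S `<=` T -> process_le C D -> (t <= u)%N ->
  running_loss_profile act f C S t w <= running_loss_profile act f D T u w.
Proof.
move=> Ct TI ST CD tu; apply: running_loss_profile_le.
  exact: running_loss_profile_ge0.
move=> v vt; apply: le_trans (running_loss_profile_ge _ _ _ (leq_trans vt tu)).
exact: loss_profile_mono.
Qed.

Lemma running_loss_profile_setI C S t u w : (t <= u)%N ->
  running_loss_profile act f C (S `&` [set` act u]) t w =
  running_loss_profile act f C S t w.
Proof.
move=> tu; apply: eq_bigr => i _; apply: loss_profile_setI.
by rewrite (leq_trans _ tu)// -ltnS.
Qed.

(** * Hulls *)

Lemma in_current_hull C t w Q : Q \in current_hull act f C t w <->
  (Q `<=` act t)%fset /\ (forall S : {fset nat}, (S `<=` act t)%fset ->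
     f [set` S] Q <= loss_profile act f C [set` S] t w).
Proof.
rewrite /current_hull !inE/= -fpowersetE.
by split=> [/andP[? /asboolP]//|[-> ?]]; exact/asboolP.
Qed.

Lemma in_running_hull C t w Q : Q \in running_hull act f C t w <->
  (Q `<=` act t)%fset /\ (forall S : {fset nat}, (S `<=` act t)%fset ->
     f [set` S] Q <= running_loss_profile act f C [set` S] t w).
Proof.
rewrite /running_hull !inE/= -fpowersetE.
by split=> [/andP[? /asboolP]//|[-> ?]]; exact/asboolP.
Qed.

Lemma in_closure_family (alpha : R) E t (w : Omega) Q :
  Q \in closure_family act f alpha E t w <->
  (Q `<=` act t)%fset /\ (forall S : {fset nat}, S != fset0 ->
     (S `<=` act t)%fset -> ((f [set` S] Q)%:E <= alpha%:E * E S t w)%E).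
Proof.
rewrite /closure_family !inE/= -fpowersetE.
by split=> [/andP[? /asboolP]//|[-> ?]]; exact/asboolP.
Qed.

Lemma within_active_closure (alpha : R) E :
  within_active act (closure_family (Omega := Omega) act f alpha E).
Proof. by move=> t w Q /in_closure_family[]. Qed.

Lemma within_active_current_hull C : within_active act (current_hull act f C).
Proof. by move=> t w Q /in_current_hull[]. Qed.

Lemma within_active_running_hull C : within_active act (running_hull act f C).
Proof. by move=> t w Q /in_running_hull[]. Qed.

Lemma loss_le_profile C S t w Q : within_active act C -> S `<=` Idx ->
  Q \in C t w -> f S Q <= loss_profile act f C S t w.
Proof.
by move=> Ct SI QC; rewrite -max_loss_profile//; exact: max_loss_ge.
Qed.

Lemma current_hull_extensive C : within_active act C ->
  process_le C (current_hull act f C).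
Proof.
move=> Ct t w; apply/fsubsetP => Q QC; apply/in_current_hull.
split=> [|S St]; first exact: Ct QC.
by apply: loss_le_profile => //; exact: subset_active_index St.
Qed.

Lemma running_hull_extensive C : within_active act C ->
  process_le C (running_hull act f C).
Proof.
move=> Ct t w; apply/fsubsetP => Q QC; apply/in_running_hull.
split=> [|S St]; first exact: Ct QC.
apply: le_trans (running_loss_profile_ge _ _ _ (leqnn t)).
by apply: loss_le_profile => //; exact: subset_active_index St.
Qed.

(** The hull conditions range over finite sets, whereas the profiles are taken
    along arbitrary ones. *)
Lemma setI_active_fset (S : set nat) t :
  S `&` [set` act t] = [set` [fset i in act t | `[< S i >]]%fset].
Proof.
apply/seteqP; split => i /=; rewrite !inE/=.
  by move=> [Si ->]; exact/asboolP.
by move=> /andP[-> /asboolP].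
Qed.

(** The defining inequality of the hull at [S `&` act t] is exactly the bound
    required of each of its members, so the hull does not raise the profile it
    is built from. *)
Lemma current_hull_profile C S t w :
  loss_profile act f (current_hull act f C) S t w <= loss_profile act f C S t w.
Proof.
apply: max_loss_le => [|Q]; first exact: max_loss_ge0.
move=> /in_current_hull[_]; rewrite setI_active_fset => fL.
rewrite -(loss_profile_setI C S w (leqnn t)) setI_active_fset; apply: fL.
by apply/fsubsetP => i; rewrite !inE => /andP[].
Qed.

(** A member of the hull at an earlier time [u] is bounded by the running
    profile at [u], which only grows up to time [t]. *)
Lemma running_hull_profile C S t w :
  running_loss_profile act f (running_hull act f C) S t w <=
  running_loss_profile act f C S t w.
Proof.
apply: running_loss_profile_le => [|u ut].
  exact: running_loss_profile_ge0.
apply: max_loss_le => [|Q]; first exact: running_loss_profile_ge0.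
move=> /in_running_hull[_]; rewrite setI_active_fset => fL.
apply: (@le_trans _ _ (running_loss_profile act f C S u w)).
  rewrite -(running_loss_profile_setI C S w (leqnn u)) setI_active_fset.
  by apply: fL; apply/fsubsetP => i; rewrite !inE => /andP[].
apply: running_loss_profile_le => [|v vu].
  exact: running_loss_profile_ge0.
exact/running_loss_profile_ge/(leq_trans vu).
Qed.

Lemma current_hull_le C D :
  (forall (S : {fset nat}) t w, (S `<=` act t)%fset ->
     loss_profile act f C [set` S] t w <= loss_profile act f D [set` S] t w) ->
  process_le (current_hull act f C) (current_hull act f D).
Proof.
move=> CD t w; apply/fsubsetP => Q /in_current_hull[Qt fL].
apply/in_current_hull; split=> // S St.
exact: le_trans (fL _ St) (CD _ _ _ St).
Qed.

Lemma running_hull_le C D :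
  (forall (S : {fset nat}) t w, (S `<=` act t)%fset ->
     running_loss_profile act f C [set` S] t w <=
     running_loss_profile act f D [set` S] t w) ->
  process_le (running_hull act f C) (running_hull act f D).
Proof.
move=> CD t w; apply/fsubsetP => Q /in_running_hull[Qt fL].
apply/in_running_hull; split=> // S St.
exact: le_trans (fL _ St) (CD _ _ _ St).
Qed.

Lemma process_le_anti C D : process_le C D -> process_le D C -> C = D.
Proof.
move=> CD DC; apply/funext => t; apply/funext => w; apply/eqP.
by rewrite eqEfsubset CD DC.
Qed.

End Profiles.

(** * Closure families of coherent collections *)

Section Coherent.
Context {Omega : Type} {alpha : R} {E : {fset nat} -> nat -> Omega -> \bar R}.
Hypothesis alpha0 : 0 < alpha.
Hypothesis f0 : null_loss Idx f.
Hypothesis E0 : forall S, S != fset0 -> [set` S] `<=` Idx ->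
  forall t w, (0 <= E S t w)%E.
Hypothesis cohE : extension_coherent Idx act E.

(** The closure condition only tests subsets of [act t].  For other [S], the
    loss of [Q] is its loss under [S `&` act t], and coherence passes from
    [S `&` act t] back to [S]; if that intersection is empty there is no
    loss. *)
Lemma closure_family_loss_le (S : {fset nat}) t w Q :
  S != fset0 -> [set` S] `<=` Idx ->
  Q \in closure_family act f alpha E t w ->
  ((f [set` S] Q)%:E <= alpha%:E * E S t w)%E.
Proof.
move=> S0 SI /in_closure_family[Qt fE]; rewrite (loss_active SI Qt) -set_fsetI.
have [St0|St0] := eqVneq (S `&` act t)%fset fset0.
  rewrite St0 set_fset0 f0; last exact: subset_active_index Qt.
  by rewrite mule_ge0 ?lee_fin ?(ltW alpha0)//; exact: E0.
apply: le_trans (fE _ St0 (fsubsetIr _ _)) _.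
by rewrite lee_pmul2l ?lte_fin//; exact: cohE.
Qed.

(** Minimality of the canonical collection, before dividing by [alpha]. *)
Lemma loss_profile_le_coherent C (S : {fset nat}) t w :
  S != fset0 -> [set` S] `<=` Idx -> within_active act C ->
  (C t w `<=` closure_family act f alpha E t w)%fset ->
  ((loss_profile act f C [set` S] t w)%:E <= alpha%:E * E S t w)%E.
Proof.
move=> S0 SI Ct /fsubsetP CE; rewrite -max_loss_profile// /max_loss.
rewrite -EFin_bigmax big_seq; apply: bigmax_le => [|Q /CE].
  by rewrite mule_ge0 ?lee_fin ?(ltW alpha0)//; exact: E0.
exact: closure_family_loss_le.
Qed.

(** New active indices impose new conditions on an old rejection set, but
    these already hold at time [t] by [closure_family_loss_le]; time
    monotonicity carries them to time [u]. *)
Lemma closure_family_nondecreasing t u w : time_monotone Idx E -> (t <= u)%N ->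
  (closure_family act f alpha E t w `<=` closure_family act f alpha E u w)%fset.
Proof.
move=> monE tu; apply/fsubsetP => Q QE; apply/in_closure_family; split.
  have /in_closure_family[Qt _] := QE.
  by apply: fsubset_trans Qt _; case: Hact => + _; exact.
move=> S S0 /subset_active_index SI.
apply: le_trans (closure_family_loss_le S0 SI QE) _.
by rewrite lee_pmul2l ?lte_fin//; exact: monE.
Qed.

End Coherent.
End Losses.

(** * Measurability of profiles, closure families and hulls *)

Section Processes.
Context {d : measure_display} {Omega : measurableType d} {R : realType}.
Context {F : nat -> set (set Omega)} {Idx : set nat}.
Context {act : nat -> {fset nat}} {f : set nat -> {fset nat} -> R}.
Hypothesis HF : filtration F.
Hypothesis Hact : active_sets Idx act.
Hypothesis Hf : bounded_loss Idx f.

Let sF t : sigma_algebra [set: Omega] (F t).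
Proof. by case: HF. Qed.

Lemma candidate_within C : candidate_process F act C -> within_active act C.
Proof. by case. Qed.

Lemma candidate_observable C t : candidate_process F act C ->
  observable (F t) (C t).
Proof.
move=> [_ Ct FC]; apply: observable_fset => // Q.
have [Qt|Qt] := boolP (Q `<=` act t)%fset; first exact: FC.
rewrite (_ : mkset _ = [set _ | False]); first exact: sigma_algebra_cst.
by apply/seteqP; split => w //= /Ct; exact/negP.
Qed.

Lemma loss_profile_observable C S t : candidate_process F act C ->
  observable (F t) (loss_profile act f C S t).
Proof.
move=> cC; exact: (observable_comp (max_loss f (S `&` [set` act t]))
  (candidate_observable t cC)).
Qed.

Lemma running_loss_profile_observable C S t : candidate_process F act C ->
  observable (F t) (running_loss_profile act f C S t).
Proof.
move=> cC; pose history w := [seq C u w | u <- iota 0 t.+1].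
(* The running profile depends on all the families up to time [t]. *)
have oh : observable (F t) history.
  apply: observable_map => // u; rewrite mem_iota add0n ltnS => /andP[_ ut] B.
  by case: HF => _ _ Fle; apply: (Fle _ _ ut); exact: candidate_observable.
rewrite (_ : running_loss_profile _ _ _ _ _ = fun w =>
  \big[Num.max/0]_(u < t.+1)
     max_loss f (S `&` [set` act u]) (nth fset0 (history w) u)).
  exact: (observable_comp (fun s => \big[Num.max/0]_(u < t.+1)
     max_loss f (S `&` [set` act u]) (nth fset0 s u)) oh).
apply/funext => w; apply: eq_bigr => u _.
by rewrite (nth_map 0%N) ?size_iota// nth_iota// add0n.
Qed.

Lemma closure_family_observable (alpha : R) E t :
  (forall S, S != fset0 -> [set` S] `<=` Idx -> adapted F (E S)) ->
  observable (F t) (closure_family act f alpha E t).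
Proof.
move=> aE; apply: observable_fset => // Q.
rewrite (_ : mkset _ =
  [set _ | (Q `<=` act t)%fset] `&` \bigcap_(S : {fset nat})
    [set w | S != fset0 -> (S `<=` act t)%fset ->
       ((f [set` S] Q)%:E <= alpha%:E * E S t w)%E]); last first.
  apply/seteqP; split=> w /=.
    by move=> /in_closure_family[Qt fE]; split=> // S _; exact: fE.
  by move=> [Qt fE]; apply/in_closure_family; split=> // S; exact: fE.
apply: sigma_algebra_setI2 => //; first exact: sigma_algebra_cst.
apply: sigma_algebra_bigcap_countType => // S.
have [->|S0] := eqVneq S fset0.
  rewrite (_ : mkset _ = [set _ | True]); first exact: sigma_algebra_cst.
  by apply/seteqP; split.
have [St|St] := boolP (S `<=` act t)%fset; last first.
  rewrite (_ : mkset _ = [set _ | True]); first exact: sigma_algebra_cst.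
  by apply/seteqP; split.
rewrite (_ : mkset _ = E S t @^-1`
  ((fun x => (alpha%:E * x)%E) @^-1` [set y | ((f [set` S] Q)%:E <= y)%E])).
  apply: aE => //; first exact: (subset_active_index Hact St).
  rewrite -[X in measurable X]setTI.
  have : measurable_fun setT (fun x : \bar R => (alpha%:E * x)%E).
    by apply: measurable_funeM; exact: measurable_id.
  apply => //.
  by rewrite -set_itvcy; exact: emeasurable_itv.
by apply/seteqP; split=> w /=; [apply|].
Qed.

Lemma current_hull_candidate C :
  candidate_process F act C -> candidate_process F act (current_hull act f C).
Proof.
move=> cC; have Ct := candidate_within cC; split.
- move=> t w; case: cC => /(_ t w)/fset0Pn[Q QC] _ _; apply/fset0Pn; exists Q.
  exact: (fsubsetP (current_hull_extensive Hact Hf Ct t w)).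
- exact: within_active_current_hull.
move=> t Q Qt; rewrite (_ : mkset _ = \bigcap_(S : {fset nat})
   loss_profile act f C [set` S] t @^-1`
     [set c | (S `<=` act t)%fset -> f [set` S] Q <= c]).
  apply: sigma_algebra_bigcap_countType => // S.
  exact: loss_profile_observable.
apply/seteqP; split=> w /=.
  by move=> /in_current_hull[_ fL] S _; exact: fL.
by move=> fL; apply/in_current_hull; split=> // S; exact: fL.
Qed.

Lemma running_hull_candidate C :
  candidate_process F act C -> candidate_process F act (running_hull act f C).
Proof.
move=> cC; have Ct := candidate_within cC; split.
- move=> t w; case: cC => /(_ t w)/fset0Pn[Q QC] _ _; apply/fset0Pn; exists Q.
  exact: (fsubsetP (running_hull_extensive Hact Hf Ct t w)).
- exact: within_active_running_hull.
move=> t Q Qt; rewrite (_ : mkset _ = \bigcap_(S : {fset nat})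
   running_loss_profile act f C [set` S] t @^-1`
     [set c | (S `<=` act t)%fset -> f [set` S] Q <= c]).
  apply: sigma_algebra_bigcap_countType => // S.
  exact: running_loss_profile_observable.
apply/seteqP; split=> w /=.
  by move=> /in_running_hull[_ fL] S _; exact: fL.
by move=> fL; apply/in_running_hull; split=> // S; exact: fL.
Qed.

(** * Hulls are closure operators *)

Lemma current_hull_closure :
  closure_operator (candidate_process F act) (@process_le Omega)
    (current_hull act f).
Proof.
split=> [C|C /candidate_within Ct|C D cC cD CD|C cC].
- exact: current_hull_candidate.
- exact: (current_hull_extensive Hact Hf Ct).
- apply: current_hull_le => S t w St.
  exact: (loss_profile_mono Hact Hf (candidate_within cC)
    (subset_active_index Hact St) _ (CD t w)).
apply: process_le_anti.
  by apply: current_hull_le => S t w St; exact: (current_hull_profile Hact).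
apply: (current_hull_extensive Hact Hf).
exact: within_active_current_hull.
Qed.

Lemma running_hull_closure :
  closure_operator (candidate_process F act) (@process_le Omega)
    (running_hull act f).
Proof.
split=> [C|C /candidate_within Ct|C D cC cD CD|C cC].
- exact: running_hull_candidate.
- exact: (running_hull_extensive Hact Hf Ct).
- apply: running_hull_le => S t w St.
  exact: (running_loss_profile_mono Hact Hf w (candidate_within cC)
    (subset_active_index Hact St) _ CD (leqnn t)).
apply: process_le_anti.
  by apply: running_hull_le => S t w St; exact: (running_hull_profile Hact).
apply: (running_hull_extensive Hact Hf).
exact: within_active_running_hull.
Qed.

(** * Canonical collections *)

Context {M : set (probability Omega R)}.
Context {H : nat -> set (probability Omega R)} {alpha : R}.
Hypothesis alpha0 : 0 < alpha.

Lemma intersection_null_sub_true_nulls P (S : {fset nat}) :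
  [set` S] `<=` Idx -> intersection_null M H S P ->
  [set` S] `<=` true_nulls Idx H P.
Proof. by move=> SI [_ HS] i Si; split; [exact: SI | exact: HS]. Qed.

Lemma true_nulls_sub P : true_nulls Idx H P `<=` Idx.
Proof. by move=> i []. Qed.

Lemma e_process_scaled (L : nat -> Omega -> R)
    (HS : set (probability Omega R)) :
  (forall t w, 0 <= L t w) -> (forall t, observable (F t) (L t)) ->
  (forall P, HS P -> forall tau, stopping_time F tau -> as_finite P tau ->
     (\int[P]_w stopped (fun t w' => (L t w')%:E) tau w <= alpha%:E)%E) ->
  e_process F HS (fun t w => (alpha^-1 * L t w)%:E).
Proof.
move=> L0 oL Lalpha; split.
- by move=> t w; rewrite lee_fin mulr_ge0// invr_ge0 ltW.
- apply: observable_adapted => t.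
  exact: (observable_comp (fun x => alpha^-1 * x) (oL t)).
move=> P HP tau st ft.
rewrite (_ : stopped _ tau =
  fun w => (alpha^-1%:E * stopped (fun t w' => (L t w')%:E) tau w)%E);
  last first.
  by apply/funext => w; rewrite /stopped; case: (tau w); rewrite ?mule0.
rewrite ge0_integralZl//.
- by rewrite lee_pdivrMl// mule1; exact: Lalpha.
- apply: (measurable_stopped HF) => // t.
  exact: (observable_measurable HF _ oL).
- by move=> w _; rewrite /stopped; case: (tau w) => // n; rewrite lee_fin.
- by rewrite lee_fin invr_ge0 ltW.
Qed.

(** Every loss of a candidate is part of the maximum that defines the profile,
    and the factor [alpha^-1] cancels the one in the closure condition.  Any
    [L] above the current profile will do, so this applies to both canonical
    collections. *)
Lemma canonical_covers C (L : set nat -> nat -> Omega -> R) t w :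
  within_active act C ->
  (forall S, loss_profile act f C S t w <= L S t w) ->
  (C t w `<=` closure_family act f alpha
     (fun S t w => (alpha^-1 * L [set` S] t w)%:E) t w)%fset.
Proof.
move=> Ct CL; apply/fsubsetP => Q QC; apply/in_closure_family; split.
  exact: Ct QC.
move=> S _ St; rewrite -EFinM mulrA divff ?gt_eqF// mul1r lee_fin.
by apply: le_trans (CL _); apply: (loss_le_profile Hact Hf) => //;
  exact: (subset_active_index Hact St).
Qed.

Lemma canonical_coherent (L : set nat -> nat -> Omega -> R) :
  (forall S t w, L (S `&` [set` act t]) t w = L S t w) ->
  extension_coherent Idx act
    (fun (S : {fset nat}) t w => (alpha^-1 * L [set` S] t w)%:E).
Proof. by move=> LI t S _ _ w; rewrite set_fsetI LI. Qed.

(** Under [P] in the intersection null of [S], the set [S] consists of true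
    nulls, so its profile is dominated by the controlled one. *)
Lemma stopped_canonical C : candidate_process F act C ->
  (forall P, M P -> forall tau, stopping_time F tau -> as_finite P tau ->
     (\int[P]_w stopped (fun t w' =>
        (loss_profile act f C (true_nulls Idx H P) t w')%:E) tau w
      <= alpha%:E)%E) ->
  e_collection F M Idx H
    (fun S t w => (alpha^-1 * loss_profile act f C [set` S] t w)%:E).
Proof.
move=> cC Calpha S _ SI; apply: e_process_scaled.
- by move=> t w; exact: max_loss_ge0.
- by move=> t; exact: loss_profile_observable.
move=> P HP tau st ft; apply: le_trans (Calpha _ (proj1 HP) _ st ft).
have mL T : measurable_fun setT
    (stopped (fun t w => (loss_profile act f C T t w)%:E) tau).
  apply: (measurable_stopped HF) => // t.
  apply: (observable_measurable HF (L := loss_profile act f C T)) => // u.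
  exact: loss_profile_observable.
apply: ge0_le_integral => // w _; rewrite /stopped; case: (tau w) => // n;
  rewrite lee_fin; first exact: max_loss_ge0.
apply: (loss_profile_mono Hact Hf (candidate_within cC)) => //.
  exact: true_nulls_sub.
exact: intersection_null_sub_true_nulls.
Qed.

(** The running profile of [S] at any stopping time stays below the supremum
    over time of the profile of the true nulls. *)
Lemma supremum_canonical C : candidate_process F act C ->
  (forall P, M P -> (\int[P]_w ereal_sup (range (fun t : nat =>
     (loss_profile act f C (true_nulls Idx H P) t w)%:E)) <= alpha%:E)%E) ->
  e_collection F M Idx H
    (fun S t w => (alpha^-1 * running_loss_profile act f C [set` S] t w)%:E).
Proof.
move=> cC Calpha S _ SI; apply: e_process_scaled.
- by move=> t w; exact: running_loss_profile_ge0.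
- by move=> t; exact: running_loss_profile_observable.
move=> P HP tau st ft; apply: le_trans (Calpha _ (proj1 HP)).
set sup := fun w => ereal_sup _.
have supge t w :
    ((loss_profile act f C (true_nulls Idx H P) t w)%:E <= sup w)%E.
  by apply: ereal_sup_ubound; exists t.
have sup0 w : (0 <= sup w)%E.
  by apply: le_trans (supge 0%N w); rewrite lee_fin; exact: max_loss_ge0.
apply: ge0_le_integral => //.
- move=> w _; rewrite /stopped; case: (tau w) => // n.
  by rewrite lee_fin running_loss_profile_ge0.
- apply: (measurable_stopped HF) => // t.
  apply: (observable_measurable HF
    (L := running_loss_profile act f C [set` S])) => // u.
  exact: running_loss_profile_observable.
- apply: measurable_ereal_sup_range => t.
  apply: (observable_measurable HF
    (L := loss_profile act f C (true_nulls Idx H P))) => // u.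
  exact: loss_profile_observable.
move=> w _; rewrite /stopped; case: (tau w) => [n|]; last exact: sup0.
rewrite /running_loss_profile -EFin_bigmax; apply: bigmax_le => [|u _].
  exact: sup0.
apply: le_trans (supge u w); rewrite lee_fin.
apply: (loss_profile_mono Hact Hf (candidate_within cC)) => //.
  exact: true_nulls_sub.
exact: intersection_null_sub_true_nulls.
Qed.

(** * Control of the stopped and of the supremum loss *)

Section Control.
Context {E : {fset nat} -> nat -> Omega -> \bar R}.
Hypothesis HE : e_collection F M Idx H E.
Hypothesis cohE : extension_coherent Idx act E.
Hypothesis f0 : null_loss Idx f.

Let E0 S : S != fset0 -> [set` S] `<=` Idx -> forall t w, (0 <= E S t w)%E.
Proof. by move=> S0 SI; case: (HE S0 SI). Qed.

Let aE S : S != fset0 -> [set` S] `<=` Idx -> adapted F (E S).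
Proof. by move=> S0 SI; case: (HE S0 SI). Qed.

Let closure_loss P t w := (max_loss f (true_nulls Idx H P)
  (closure_family act f alpha E t w))%:E.

Lemma measurable_closure_loss P t :
  measurable_fun setT (closure_loss P t).
Proof.
apply: (observable_measurable HF (L := fun t w =>
  max_loss f (true_nulls Idx H P) (closure_family act f alpha E t w))) => // u.
exact: (observable_comp (max_loss f _) (closure_family_observable _ _ aE)).
Qed.

(** One e-process, that of the true nulls active at the horizon [n], controls
    the loss at all times up to [n].  The first alternative covers the case
    where no true null is active at [n]: there is then no e-process to use, but
    no loss either. *)
Lemma closure_loss_le_horizon P (S : {fset nat}) n k w :
  true_nulls Idx H P `&` [set` act n] = [set` S] -> (k <= n)%N ->
  closure_loss P k w = 0%E \/
  [/\ S != fset0, [set` S] `<=` Idx &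
      (closure_loss P k w <= alpha%:E * E S k w)%E].
Proof.
move=> NS kn.
have SI : [set` S] `<=` Idx by rewrite -NS => i [/true_nulls_sub].
have cl := @within_active_closure _ act f Omega alpha E.
rewrite /closure_loss (max_loss_profile Hact Hf k w cl (@true_nulls_sub P)).
rewrite -(loss_profile_setI Hact _ _ w kn) NS.
have [S0|S0] := eqVneq S fset0; last first.
  by right; split=> //; exact: (loss_profile_le_coherent Hact Hf alpha0 f0).
left; congr EFin; apply/eqP; rewrite eq_le max_loss_ge0 andbT.
apply: max_loss_le => // Q /cl Qt; rewrite S0 set_fset0 set0I f0//.
exact: (subset_active_index Hact Qt).
Qed.

(** The horizon [n] makes the set of true nulls finite; the bound [alpha] does
    not depend on [n], so monotone convergence concludes. *)
Lemma stopped_loss_le P : M P -> forall tau, stopping_time F tau ->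
  (\int[P]_w stopped (closure_loss P) tau w <= alpha%:E)%E.
Proof.
move=> MP tau st.
have l0 t w : (0 <= closure_loss P t w)%E by rewrite lee_fin max_loss_ge0.
pose g n := stopped (fun k w =>
  if (k <= n)%N then closure_loss P k w else 0%E) tau.
have g0 n w : (0 <= g n w)%E.
  by rewrite /g /stopped; case: (tau w) => // k; case: ifP.
have mg n : measurable_fun setT (g n).
  apply: (measurable_stopped HF) => // k; case: leqP => _.
    exact: measurable_closure_loss.
  exact: measurable_cst.
under eq_integral => w _ do rewrite stopped_ereal_sup//.
apply: (integral_ereal_sup_le (g := g)) => //.
  move=> w m n mn; rewrite /g /stopped; case: (tau w) => // k.
  by case: ifP => [km|_]; [rewrite (leq_trans km mn) | case: ifP].
move=> n; set S := [fset i in act n | `[< true_nulls Idx H P i >]]%fset.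
have NS : true_nulls Idx H P `&` [set` act n] = [set` S].
  exact: setI_active_fset.
have SI : [set` S] `<=` Idx by rewrite -NS => i [/true_nulls_sub].
have [S0|S0] := eqVneq S fset0.
  rewrite integral0_eq ?lee_fin ?ltW// => w _.
  rewrite /g /stopped; case: (tau w) => // k; case: ifP => // kn.
  by have [//|[]] := closure_loss_le_horizon w NS kn; rewrite S0 eqxx.
have [_ _ /(_ P) Ecap] := HE S0 SI.
have mE : measurable_fun setT (stopped (E S) (capped n tau)).
  apply: (measurable_stopped HF); last exact: stopping_time_capped.
  by move=> t; apply: (adapted_measurable HF); exact: aE.
have sE0 w : (0 <= stopped (E S) (capped n tau) w)%E by exact: E0.
apply: (@le_trans _ _
  (\int[P]_w (alpha%:E * stopped (E S) (capped n tau) w))%E).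
  apply: ge0_le_integral => //; first exact: measurable_funeM.
  move=> w _; have aE0 : (0 <= alpha%:E * stopped (E S) (capped n tau) w)%E.
    by rewrite mule_ge0// lee_fin ltW.
  move: aE0; rewrite /g /stopped /capped; case: (tau w) => // k aE0.
  case: ifP => // kn; move: aE0; rewrite (minn_idPl kn).
  by have [->|[]] := closure_loss_le_horizon w NS kn.
rewrite ge0_integralZl//; last by rewrite lee_fin ltW.
rewrite -[leRHS]mule1 lee_pmul2l ?lte_fin//; apply: Ecap.
- split=> // i Si.
  by have [[]] : (true_nulls Idx H P `&` [set` act n]) i by rewrite NS.
- exact: stopping_time_capped.
- exact: as_finite_total.
Qed.

Lemma supremum_loss_le P : M P -> time_monotone Idx E ->
  (\int[P]_w ereal_sup (range (fun t => closure_loss P t w)) <= alpha%:E)%E.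
Proof.
move=> MP monE; apply: (integral_ereal_sup_le (g := closure_loss P)).
- by move=> t; exact: measurable_closure_loss.
- by move=> t w; rewrite lee_fin max_loss_ge0.
- move=> w t u tu; rewrite lee_fin; apply: max_loss_le => [|Q QE].
    exact: max_loss_ge0.
  apply/max_loss_ge/(fsubsetP _ _ QE).
  exact: (closure_family_nondecreasing Hact Hf alpha0 f0).
by move=> t; exact: (stopped_loss_le MP (stopping_time_cst HF t)).
Qed.

End Control.
End Processes.

Theorem theorem3p12 (d : measure_display) (Omega : measurableType d)
    (R : realType) (F : nat -> set (set Omega))
    (M : set (probability Omega R)) (Idx : set nat)
    (H : nat -> set (probability Omega R)) (act : nat -> {fset nat})
    (alpha : R) (f : set nat -> {fset nat} -> R)
    (HF : filtration F)
    (HH : forall i, Idx i -> H i `<=` M)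
    (Hact : active_sets Idx act)
    (Halpha : 0 < alpha <= 1)
    (Hf : bounded_loss Idx f) :
  (* (1) stopped loss *)
  (null_loss Idx f ->
   forall E : {fset nat} -> nat -> Omega -> \bar R,
     e_collection F M Idx H E -> extension_coherent Idx act E ->
     forall P, M P -> forall tau, stopping_time F tau -> as_finite P tau ->
       (\int[P]_w stopped (fun t w' =>
          (max_loss f (true_nulls Idx H P)
                      (closure_family act f alpha E t w'))%:E) tau w
        <= alpha%:E)%E) /\
  (* (2) persistent supremum loss *)
  (null_loss Idx f ->
   forall E : {fset nat} -> nat -> Omega -> \bar R,
     e_collection F M Idx H E -> extension_coherent Idx act E ->
     time_monotone Idx E ->
     (forall P, M P ->
        (\int[P]_w ereal_sup (range (fun t : nat =>
           (max_loss f (true_nulls Idx H P)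
                       (closure_family act f alpha E t w))%:E))
         <= alpha%:E)%E) /\
     (forall t u, (t <= u)%N -> forall w,
        (closure_family act f alpha E t w
           `<=` closure_family act f alpha E u w)%fset)) /\
  (* (3) canonical converse, stopped *)
  (forall C : nat -> Omega -> {fset {fset nat}},
     candidate_process F act C ->
     (forall P, M P -> forall tau, stopping_time F tau -> as_finite P tau ->
        (\int[P]_w stopped (fun t w' =>
           (loss_profile act f C (true_nulls Idx H P) t w')%:E) tau w
         <= alpha%:E)%E) ->
     let Ecan := fun (S : {fset nat}) (t : nat) (w : Omega) =>
       (alpha^-1 * loss_profile act f C [set` S] t w)%:E in
     [/\ e_collection F M Idx H Ecan,
         extension_coherent Idx act Ecan
       & forall t w, (C t w `<=` closure_family act f alpha Ecan t w)%fset]) /\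
  (* (4) canonical converse, supremum *)
  (forall C : nat -> Omega -> {fset {fset nat}},
     candidate_process F act C ->
     (forall P, M P ->
        (\int[P]_w ereal_sup (range (fun t : nat =>
           (loss_profile act f C (true_nulls Idx H P) t w)%:E))
         <= alpha%:E)%E) ->
     let Ecan := fun (S : {fset nat}) (t : nat) (w : Omega) =>
       (alpha^-1 * running_loss_profile act f C [set` S] t w)%:E in
     [/\ e_collection F M Idx H Ecan,
         extension_coherent Idx act Ecan,
         time_monotone Idx Ecan
       & forall t w, (C t w `<=` closure_family act f alpha Ecan t w)%fset]) /\
  (* (5) minimality *)
  (null_loss Idx f ->
   forall (C : nat -> Omega -> {fset {fset nat}})
          (E : {fset nat} -> nat -> Omega -> \bar R),
     candidate_process F act C ->
     e_collection F M Idx H E -> extension_coherent Idx act E ->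
     (forall t w, (C t w `<=` closure_family act f alpha E t w)%fset) ->
     (forall S : {fset nat}, S != fset0 -> [set` S] `<=` Idx -> forall t w,
        ((alpha^-1 * loss_profile act f C [set` S] t w)%:E <= E S t w)%E) /\
     (time_monotone Idx E ->
      forall S : {fset nat}, S != fset0 -> [set` S] `<=` Idx -> forall t w,
        ((alpha^-1 * running_loss_profile act f C [set` S] t w)%:E
           <= E S t w)%E)) /\
  (* (6) hulls *)
  (closure_operator (candidate_process F act) (@process_le Omega)
     (current_hull act f) /\
   closure_operator (candidate_process F act) (@process_le Omega)
     (running_hull act f)).
Proof.
have alpha0 : 0 < alpha by case/andP: Halpha.
have E0 E : e_collection F M Idx H E -> forall S, S != fset0 ->
    [set` S] `<=` Idx -> forall t w, (0 <= E S t w)%E.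
  by move=> HE S S0 SI; case: (HE S S0 SI).
split; [|split; [|split; [|split; [|split]]]].
- move=> f0 E HE cohE P MP tau st _.
  exact: (stopped_loss_le HF Hact Hf alpha0 HE cohE f0 MP st).
- move=> f0 E HE cohE monE; split=> [P MP|t u tu w].
    exact: (supremum_loss_le HF Hact Hf alpha0 HE cohE f0 MP monE).
  exact: (closure_family_nondecreasing Hact Hf alpha0 f0 (E0 _ HE)).
- move=> C cC Calpha; split; first exact: stopped_canonical.
  + apply: (canonical_coherent (L := loss_profile act f C)) => S t w.
    exact: (loss_profile_setI Hact).
  + move=> t w; apply: (canonical_covers Hact Hf alpha0
      (L := loss_profile act f C) (candidate_within cC)) => S.
    exact: lexx.
- move=> C cC Calpha; split; first exact: supremum_canonical.
  + apply: (canonical_coherent (L := running_loss_profile act f C)) => S t w.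
    exact: (running_loss_profile_setI Hact).
  + move=> S S0 SI t u tu w; rewrite lee_fin ler_pM2l ?invr_gt0//.
    exact: (running_loss_profile_mono Hact Hf w (candidate_within cC)).
  + move=> t w; apply: (canonical_covers Hact Hf alpha0
      (L := running_loss_profile act f C) (candidate_within cC)) => S.
    exact: running_loss_profile_ge.
- move=> f0 C E cC HE cohE CE.
  have LE S : S != fset0 -> [set` S] `<=` Idx -> forall t w,
      ((loss_profile act f C [set` S] t w)%:E <= alpha%:E * E S t w)%E.
    move=> S0 SI t w; have Ct := candidate_within cC.
    exact: (loss_profile_le_coherent Hact Hf alpha0 f0 (E0 _ HE)).
  split=> [S S0 SI t w|monE S S0 SI t w].
    by rewrite EFinM lee_pdivrMl//; exact: LE.
  rewrite EFinM lee_pdivrMl// /running_loss_profile -EFin_bigmax.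
  apply: bigmax_le => [|u _].
    by rewrite mule_ge0 ?lee_fin ?(ltW alpha0)//; exact: (E0 _ HE).
  apply: le_trans (LE S S0 SI u w) _; rewrite lee_pmul2l ?lte_fin//.
  by apply: monE => //; rewrite -ltnS.
split; first exact: (current_hull_closure HF Hact Hf).
exact: (running_hull_closure HF Hact Hf).
Qed.
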